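(* An abelian ring is weakly nil clean if and only if it is strongly $\pi$-regular.
   Context: Rings are associative with unity, not necessarily commutative. A ring is abelian if all its idempotents are central. A ring $R$ is weakly nil clean if for every $a\in R$ there exist an idempotent $e\in R$ and a nilpotent $q\in R$ such that $a-e-q\in eRa$. A ring $R$ is strongly $\pi$-regular if for every $a\in R$ there exists a positive integer $n$ such that $a^n\in a^{n+1}R$. *)

(* Defs.v *)
From mathcomp Require Import all_boot all_algebra.
Set Implicit Arguments.
Unset Strict Implicit.
Unset Printing Implicit Defensive.
Import GRing.Theory.
Local Open Scope ring_scope.

(* Rings are pzRingType: associative and unital, possibly noncommutative, and
   possibly the zero ring (nzRingType would impose 1 != 0). *)

Definition ring_idempotent (R : pzRingType) (e : R) : Prop := e * e = e.

Definition ring_nilpotent (R : pzRingType) (q : R) : Prop :=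
  exists n : nat, (0 < n)%N /\ q ^+ n = 0.

Definition ring_central (R : pzRingType) (c : R) : Prop :=
  forall x : R, GRing.comm c x.

Definition abelian_ring (R : pzRingType) : Prop :=
  forall e : R, ring_idempotent e -> ring_central e.

Definition weakly_nil_clean (R : pzRingType) : Prop :=
  forall a : R, exists e q : R,
    [/\ ring_idempotent e, ring_nilpotent q
      & exists r : R, a - e - q = e * r * a].

Definition strongly_pi_regular (R : pzRingType) : Prop :=
  forall a : R, exists n : nat,
    (0 < n)%N /\ exists r : R, a ^+ n = a ^+ n.+1 * r.

(* Main.v *)
(* Forward: if a - e - q = e r a with e a central idempotent and q nilpotent,
   then (1 - e) a = (1 - e) q is nilpotent, while e is a left multiple of e a
   because 1 + q is a unit; as idempotents are central, one-sided inverses in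
   the corner e R are two-sided, so e is also a right multiple of e a.
   Backward: Dischinger's argument makes some power a^n von Neumann regular,
   a^n = a^n s a^n.  Then e = a^n s is a central idempotent which is a left
   multiple of a, and (1 - e) a is nilpotent. *)
Require Import Defs.
From mathcomp Require Import all_boot all_algebra.
Import GRing.Theory.
Local Open Scope ring_scope.

(** The inverse is the finite geometric series in [- q]. *)
Lemma nilpotent_add1_left_inverse (R : pzRingType) (q : R) :
  ring_nilpotent q -> exists u : R, u * (1 + q) = 1.
Proof.
case=> n [_ qn0]; exists (\sum_(i < n) (- q) ^+ i).
have cq : GRing.comm (1 + q) (\sum_(i < n) (- q) ^+ i).
  apply: commr_sum => i _; apply/commrX/commrN/commr_sym/commrD.
    exact: commr1.
  exact: commr_refl.
have := subrX1 (- q) n.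
rewrite exprNn qn0 mulr0 sub0r -opprD mulNr [q + 1]addrC => /oppr_inj; rewrite cq.
exact: esym.
Qed.

Lemma complement_idempotent (R : pzRingType) (e : R) :
  ring_idempotent e -> ring_idempotent (1 - e).
Proof.
by rewrite /ring_idempotent => ee; rewrite mulrBl mul1r mulrBr mulr1 ee subrr subr0.
Qed.

Lemma idempotentX (R : pzRingType) (e : R) (n : nat) :
  ring_idempotent e -> (0 < n)%N -> e ^+ n = e.
Proof.
by move=> ee; elim: n => // -[|n] IHn _; rewrite ?expr1 // exprS IHn.
Qed.

Lemma abelian_corner_right_inverse (R : pzRingType) (e a y : R) :
  abelian_ring R -> ring_idempotent e -> e = e * y * a -> e = a * (e * y).
Proof.
move=> abR ee eya; have ce := abR e ee; set f := a * (e * y).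
have fa : f * a = a * e by rewrite -mulrA -eya.
have ff : ring_idempotent f.
  by rewrite /ring_idempotent {2}/f mulrA fa -mulrA [e * (e * y)]mulrA ee.
have fe : f * e = f by rewrite -ce /f !mulrA ce -(mulrA a) ee.
(* As [f] is central, [f = f * e = e * y * (f * a) = e * y * a * e = e]. *)
rewrite -fe {2}eya (mulrA f) (abR _ ff (e * y)) -mulrA fa mulrA -eya.
exact: esym ee.
Qed.

Lemma right_quotientX (R : pzRingType) (a r : R) (n m : nat) :
  a ^+ n = a ^+ n.+1 * r -> (n <= m)%N -> a ^+ m = a ^+ m * a ^+ m * r ^+ m.
Proof.
move=> an nm; rewrite -exprD.
have am : a ^+ m = a ^+ m.+1 * r.
  by rewrite -(subnK nm) exprD {1}an mulrA -exprD addnS.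
(* Induction on [k] in [a ^+ m = a ^+ (m + k) * r ^+ k], with base exponent [m] fixed. *)
elim: {3 4}m => [|k IHk]; first by rewrite addn0 mulr1.
by rewrite {1}am exprS {1}IHk -!mulrA -exprSr mulrA -exprS addnS.
Qed.

Lemma right_quotient_cancelX (R : pzRingType) (b c : R) (k : nat) :
  b = b * b * c -> b ^+ k.+1 * c ^+ k = b.
Proof.
move=> bbc; elim: k => [|k IHk]; first by rewrite mulr1.
by rewrite exprS (exprSr c) mulrA -(mulrA b) IHk -bbc.
Qed.

(* Here a c = a^2, so (c - a)^(k+1) = c^k (c - a); strong pi-regularity of
   c - a, multiplied on the left by a power of b, then gives
   b^2 (c - a) = b (c - a) x, and multiplying by a^2 kills the right side. *)
Lemma strongly_pi_regular_inner_inverse (R : pzRingType) (a b c : R) :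
  strongly_pi_regular R -> a = a * a * b -> b = b * b * c -> a = a * b * a.
Proof.
move=> spR aab bbc.
have abc : a * b * c = a.
  by rewrite {1}aab -!mulrA [b * (b * c)]mulrA -bbc mulrA -aab.
have ac : a * c = a * a by rewrite {1}aab -!mulrA [a * (b * c)]mulrA abc.
have aca : a * (c - a) = 0 by rewrite mulrBr ac subrr.
have cX k : (c - a) ^+ k.+1 = c ^+ k * (c - a).
  elim: k => [|k IHk]; first by rewrite mul1r.
  by rewrite exprSr IHk -mulrA mulrBl aca subr0 mulrA -exprSr.
have [[|n] [n_gt0 [x]]] := spR (c - a); first by [].
rewrite !cX => cx.
(* Left multiplication by [b ^+ n.+2] turns [c ^+ n] into [b * b] and [c ^+ n.+1] into [b]. *)
have bx : b * b * (c - a) = b * (c - a) * x.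
  have := congr1 (fun z => b ^+ n.+2 * z) cx.
  rewrite /= !mulrA right_quotient_cancelX // {1}exprS -(mulrA b).
  by rewrite right_quotient_cancelX.
have := congr1 (fun z => a * a * z) bx.
rewrite /= !mulrA -aab aca mul0r mulrBr abc => /eqP.
by rewrite subr_eq0 => /eqP.
Qed.

(** Strong pi-regularity of [a] gives [r], and that of [r] gives [t]; the exponent [n + m] is large
    enough for both relations. *)
Lemma strongly_pi_regular_power_regular (R : pzRingType) (a : R) :
  strongly_pi_regular R ->
  exists n s, (0 < n)%N /\ a ^+ n = a ^+ n * s * a ^+ n.
Proof.
move=> spR; have [n [n_gt0 [r ar]]] := spR a; have [m [_ [t rt]]] := spR r.
exists (n + m)%N, (r ^+ (n + m)); split; first by rewrite addn_gt0 n_gt0.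
apply: (strongly_pi_regular_inner_inverse R _ _ (t ^+ (n + m)) spR).
  by apply: right_quotientX ar _; rewrite leq_addr.
by apply: right_quotientX rt _; rewrite leq_addl.
Qed.

Lemma weakly_nil_clean_strongly_pi_regular (R : pzRingType) :
  abelian_ring R -> weakly_nil_clean R -> strongly_pi_regular R.
Proof.
move=> abR wR a; have [e [q [ee qnil [r aeq]]]] := wR a.
have ce := abR e ee; have [u u1q] := nilpotent_add1_left_inverse R q qnil.
(* Multiply the decomposition by [e]; [u] then cancels [1 + q]. *)
have ea : e * (1 - r) * a = e * (1 + q).
  have := congr1 (fun z => e * z) aeq.
  rewrite /= !mulrBr !mulrA ee mulr1 mulrBl => <-.
  by rewrite -addrA -opprD subKr mulrDr mulr1.
have na : (1 - e) * a = (1 - e) * q.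
  have fe0 : (1 - e) * e = 0 by rewrite mulrBl mul1r ee subrr.
  have := congr1 (fun z => (1 - e) * z) aeq.
  rewrite /= !mulrBr !mulrA fe0 !mul0r subr0 => /eqP.
  by rewrite subr_eq0 => /eqP.
have eya : e = e * (u * (1 - r)) * a.
  by rewrite mulrA ce -!mulrA (mulrA e) ea ce mulrA u1q mul1r.
have eay := abelian_corner_right_inverse R e a _ abR ee eya.
have [n [n_gt0 qn]] := qnil; exists n; split=> //.
exists (e * (u * (1 - r))).
have fi := complement_idempotent R e ee.
have an : (1 - e) * a ^+ n = 0.
  rewrite -(idempotentX R _ n fi n_gt0) -exprMn_comm; last exact: abR.
  by rewrite na exprMn_comm ?qn ?mulr0 //; apply: abR.
rewrite exprSr -mulrA -eay -ce.
by move/eqP: an; rewrite mulrBl mul1r subr_eq0 => /eqP.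
Qed.

Lemma strongly_pi_regular_weakly_nil_clean (R : pzRingType) :
  abelian_ring R -> strongly_pi_regular R -> weakly_nil_clean R.
Proof.
move=> abR spR a.
have [n [s [n_gt0 asa]]] := strongly_pi_regular_power_regular R a spR.
set b := a ^+ n in asa; pose e := b * s; pose g := s * b.
have ee : ring_idempotent e by rewrite /ring_idempotent /e mulrA -asa.
have gg : ring_idempotent g.
  by rewrite /ring_idempotent /g -mulrA (mulrA b) -asa.
have eb : e * b = b by rewrite /e -asa.
have ce := abR e ee; have cg := abR g gg.
have fi := complement_idempotent R e ee.
(* Since [g * b = b * g = b]; hence [e = e * s * a ^+ n], a left multiple of [a]. *)
have ege : e = e * g by rewrite -cg /e mulrA cg /g mulrA -asa.
exists e, ((1 - e) * a); split=> //.
  exists n; split=> //; rewrite exprMn_comm; last exact: abR.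
  by rewrite (idempotentX R _ n fi n_gt0) -/b mulrBl mul1r eb subrr.
(* The remainder to match is [e * a - e], and [e = e * (s * a ^+ n.-1) * a]. *)
exists (1 - s * a ^+ n.-1).
have -> : e * (1 - s * a ^+ n.-1) * a = e * a - e * g.
  by rewrite mulrBr mulr1 mulrBl -!mulrA -exprSr prednK.
by rewrite -ege mulrBl mul1r addrAC subKr.
Qed.

Theorem proposition3p8 (R : pzRingType) (hR : abelian_ring R) :
  weakly_nil_clean R <-> strongly_pi_regular R.
Proof.
split; first exact: weakly_nil_clean_strongly_pi_regular.
exact: strongly_pi_regular_weakly_nil_clean.
Qed.
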